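(* Let $(D,X)$ be a Dyer system of finite type and let $\{P_i\mid i\in I\}$ be a non-empty collection of parabolic subgroups of $D$. Then $\bigcap_{i\in I}P_i$ is a parabolic subgroup of $D$.
   Context: Dyer systems. Let $\Gamma$ be a simplicial graph with vertex set $V(\Gamma)$ and edge set $E(\Gamma)$, with maps $m:E(\Gamma)\to\mathbb N_{\ge2}$ and $f:V(\Gamma)\to\mathbb N_{\ge2}\cup\{\infty\}$ such that for each edge $e=\{u,v\}$, if $m(e)\neq2$ then $f(u)=f(v)=2$. The Dyer group $D=D(\Gamma,m,f)$ is the group with generators $x_v$ ($v\in V(\Gamma)$) and relations $x_v^{f(v)}=1$ for all $v$ with $f(v)\ne\infty$, and $x_ux_vx_u\cdots=x_vx_ux_v\cdots$ (alternating products with $m(e)$ factors on each side) for all $e=\{u,v\}\in E(\Gamma)$. The pair $(D,X)$ with $X=\{x_v\mid v\in V(\Gamma)\}$ is called a Dyer system (it is known that $v\mapsto x_v$ is injective). It is of finite type if $X$ is finite. For $Y\subset X$, $D_Y$ denotes the subgroup of $D$ generated by $Y$. A parabolic subgroup of $D$ is a subgroup of the form $gD_Yg^{-1}$ with $Y\subset X$ and $g\in D$. *)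

(* Defs.v *)
From HB Require Import structures.
From mathcomp Require Import all_boot.
From mathcomp Require Import boolp classical_sets cardinality.

Set Implicit Arguments.
Unset Strict Implicit.
Unset Printing Implicit Defensive.

Local Open Scope group_scope.
Local Open Scope quotient_scope.
Local Open Scope classical_set_scope.

Section Presentation.
Variable V : choiceType.

(* The letter [(v, false)] stands for the generator v, [(v, true)] for its
   inverse. *)
Definition word := seq (V * bool).

Definition inv_letter (a : V * bool) : V * bool := (a.1, ~~ a.2).

Definition inv_word (w : word) : word := rev (map inv_letter w).

Definition pos_word (s : seq V) : word := [seq (v, false) | v <- s].

Variable rel : word -> word -> Prop.

(* Equality of words in < V | l = r for all l, r with rel l r >. *)
Inductive pres_eq : word -> word -> Prop :=
| pres_eq_rel l r : rel l r -> pres_eq l r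
| pres_eq_cancel a : pres_eq [:: a; inv_letter a] [::]
| pres_eq_refl w : pres_eq w w
| pres_eq_sym w1 w2 : pres_eq w1 w2 -> pres_eq w2 w1
| pres_eq_trans w1 w2 w3 : pres_eq w1 w2 -> pres_eq w2 w3 -> pres_eq w1 w3
| pres_eq_cat w1 w1' w2 w2' :
    pres_eq w1 w1' -> pres_eq w2 w2' -> pres_eq (w1 ++ w2) (w1' ++ w2').

Definition pres_eqb (w1 w2 : word) : bool := `[< pres_eq w1 w2 >].

Lemma pres_eqb_refl : reflexive pres_eqb.
Proof. by move=> w; apply/asboolP; exact: pres_eq_refl. Qed.

Lemma pres_eqb_sym : symmetric pres_eqb.
Proof. by move=> w1 w2; apply/asboolP/asboolP; exact: pres_eq_sym. Qed.

Lemma pres_eqb_trans : transitive pres_eqb.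
Proof.
move=> w2 w1 w3 /asboolP h1 /asboolP h2.
by apply/asboolP; exact: pres_eq_trans h1 h2.
Qed.

Canonical pres_equiv := EquivRel pres_eqb pres_eqb_refl pres_eqb_sym
  pres_eqb_trans.

Definition presented : Type := {eq_quot pres_equiv}.
HB.instance Definition _ := Choice.on presented.
HB.instance Definition _ := EqQuotient.on presented.

Definition word_class (w : word) : presented := \pi_presented w.

Lemma word_classP w1 w2 : word_class w1 = word_class w2 <-> pres_eq w1 w2.
Proof. by split=> [/eqmodP/asboolP|h]; [|apply/eqmodP/asboolP]. Qed.

Lemma pres_eq_repr w : pres_eq (repr (word_class w)) w.
Proof. by apply/word_classP; rewrite /word_class reprK. Qed.

Lemma inv_word_cat w1 w2 : inv_word (w1 ++ w2) = inv_word w2 ++ inv_word w1.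
Proof. by rewrite /inv_word map_cat rev_cat. Qed.

Lemma inv_letterK : involutive inv_letter.
Proof. by case=> v b; rewrite /inv_letter /= negbK. Qed.

Lemma inv_wordK : involutive inv_word.
Proof. by move=> w; rewrite /inv_word map_rev revK mapK //; exact: inv_letterK. Qed.

Lemma pres_eq_catV w : pres_eq (w ++ inv_word w) [::].
Proof.
elim: w => [|a w IH]; first exact: pres_eq_refl.
rewrite -cat1s inv_word_cat -catA (catA w).
apply: pres_eq_trans (pres_eq_cancel a).
apply: (@pres_eq_cat [:: a] [:: a] _ [:: inv_letter a]).
  exact: pres_eq_refl.
exact: (@pres_eq_cat _ [::] _ _ IH (pres_eq_refl _)).
Qed.

Lemma pres_eq_catVw w : pres_eq (inv_word w ++ w) [::].
Proof. by have := pres_eq_catV (inv_word w); rewrite inv_wordK. Qed.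

Lemma pres_eq_inv w1 w2 :
  pres_eq w1 w2 -> pres_eq (inv_word w1) (inv_word w2).
Proof.
move=> h.
have h1 : pres_eq (inv_word w1 ++ (w2 ++ inv_word w2)) (inv_word w1).
  rewrite -[X in pres_eq _ X]cats0.
  by apply: pres_eq_cat; [exact: pres_eq_refl|exact: pres_eq_catV].
apply: pres_eq_trans (pres_eq_sym h1) _.
rewrite catA -[X in pres_eq _ X]cat0s.
apply: pres_eq_cat; last exact: pres_eq_refl.
apply: pres_eq_trans (pres_eq_catVw w1).
by apply: pres_eq_cat; [exact: pres_eq_refl|exact: pres_eq_sym].
Qed.

Definition pres_one : presented := word_class [::].
Definition pres_mul (a b : presented) : presented :=
  word_class (repr a ++ repr b).
Definition pres_inv (a : presented) : presented :=
  word_class (inv_word (repr a)).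

Lemma pres_mulE w1 w2 :
  pres_mul (word_class w1) (word_class w2) = word_class (w1 ++ w2).
Proof. by apply/word_classP; apply: pres_eq_cat; exact: pres_eq_repr. Qed.

Lemma pres_invE w : pres_inv (word_class w) = word_class (inv_word w).
Proof. by apply/word_classP; apply: pres_eq_inv; exact: pres_eq_repr. Qed.

Lemma word_class_ind (P : presented -> Prop) :
  (forall w, P (word_class w)) -> forall a, P a.
Proof. by move=> h a; rewrite -[a]reprK; exact: h. Qed.

Lemma pres_mulA : associative pres_mul.
Proof.
elim/word_class_ind=> a; elim/word_class_ind=> b; elim/word_class_ind=> c.
by rewrite !pres_mulE catA.
Qed.

Lemma pres_mul1 : left_id pres_one pres_mul.
Proof. by elim/word_class_ind=> a; rewrite pres_mulE. Qed.

Lemma pres_mulr1 : right_id pres_one pres_mul.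
Proof. by elim/word_class_ind=> a; rewrite pres_mulE cats0. Qed.

Lemma pres_mulV : left_inverse pres_one pres_inv pres_mul.
Proof.
elim/word_class_ind=> a; rewrite pres_invE pres_mulE.
by apply/word_classP; exact: pres_eq_catVw.
Qed.

Lemma pres_mulrV : right_inverse pres_one pres_inv pres_mul.
Proof.
elim/word_class_ind=> a; rewrite pres_invE pres_mulE.
by apply/word_classP; exact: pres_eq_catV.
Qed.

HB.instance Definition _ := isGroup.Build presented
  pres_mulA pres_mul1 pres_mulr1 pres_mulV pres_mulrV.

Definition pres_gen (v : V) : presented := word_class [:: (v, false)].

Lemma word_class_cat w1 w2 :
  word_class (w1 ++ w2) = word_class w1 * word_class w2.
Proof. by rewrite -pres_mulE. Qed.

Lemma word_class_pos (s : seq V) :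
  word_class (pos_word s) = \prod_(v <- s) pres_gen v.
Proof.
elim: s => [|v s IH]; first by rewrite big_nil.
by rewrite big_cons -IH -word_class_cat.
Qed.

Definition eval_word (G : groupType) (x : V -> G) (w : word) : G :=
  \prod_(a <- w) (if a.2 then (x a.1)^-1 else x a.1).

Lemma pres_eq_eval (G : groupType) (x : V -> G) :
  (forall l r, rel l r -> eval_word x l = eval_word x r) ->
  forall w1 w2, pres_eq w1 w2 -> eval_word x w1 = eval_word x w2.
Proof.
move=> xrel w1 w2; elim=> {w1 w2} //.
- by case=> v [];
    rewrite /eval_word !big_cons !big_nil /= mulg1 ?mulVg ?mulgV.
- by move=> w1 w2 w3 _ -> _ ->.
- by move=> w1 w1' w2 w2' _ h1 _ h2; rewrite /eval_word !big_cat /=; congr (_ * _).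
Qed.

(* The universal property of the presentation. *)
Lemma presented_lift (G : groupType) (x : V -> G) :
  (forall l r, rel l r -> eval_word x l = eval_word x r) ->
  exists phi : presented -> G,
    {morph phi : a b / a * b} /\ forall v, phi (pres_gen v) = x v.
Proof.
move=> xrel; exists (eval_word x \o repr).
have phiE w : eval_word x (repr (word_class w)) = eval_word x w.
  by apply: (pres_eq_eval xrel); exact: pres_eq_repr.
split=> [|v] /=; last by rewrite phiE /eval_word big_seq1.
elim/word_class_ind=> a; elim/word_class_ind=> b /=.
by rewrite -word_class_cat !phiE /eval_word big_cat.
Qed.

End Presentation.

(* The simplicial graph of a Dyer system with its labels.  The values of
   [edge_label] outside of the edges are irrelevant, and [vertex_label v = None]
   encodes f(v) = oo. *)
Record dyer_graph (V : choiceType) := DyerGraph {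
  adj : rel V;
  edge_label : V -> V -> nat;
  vertex_label : V -> option nat;
  adj_sym : symmetric adj;
  adj_irrefl : irreflexive adj;
  edge_label_sym : forall u v, adj u v -> edge_label u v = edge_label v u;
  edge_label_ge2 : forall u v, adj u v -> 2 <= edge_label u v;
  vertex_label_ge2 : forall v n, vertex_label v = Some n -> 2 <= n;
  edge_label_neq2 : forall u v, adj u v -> edge_label u v <> 2 ->
    vertex_label u = Some 2 /\ vertex_label v = Some 2 }.

Section Dyer.
Variables (V : choiceType) (Gamma : dyer_graph V).

(* The alternating sequence u, v, u, ... of length n. *)
Fixpoint alternating (n : nat) (u v : V) : seq V :=
  if n is k.+1 then u :: alternating k v u else [::].

Inductive dyer_rel : word V -> word V -> Prop :=
| dyer_rel_pow v n : vertex_label Gamma v = Some n ->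
    dyer_rel (pos_word (nseq n v)) [::]
| dyer_rel_braid u v : adj Gamma u v ->
    dyer_rel (pos_word (alternating (edge_label Gamma u v) u v))
             (pos_word (alternating (edge_label Gamma u v) v u)).

Definition dyer_group := presented dyer_rel.
HB.instance Definition _ := Group.on dyer_group.

Definition dyer_gen (v : V) : dyer_group := pres_gen dyer_rel v.

Definition dyer_gens : set dyer_group := range dyer_gen.

Lemma dyer_gen_pow v n : vertex_label Gamma v = Some n -> dyer_gen v ^+ n = 1.
Proof.
move=> fv; have /pres_eq_rel/word_classP := dyer_rel_pow fv.
rewrite word_class_pos big_nseq => h.
transitivity (word_class dyer_rel [::]); last by [].
by rewrite -h; elim: n {fv h} => // n IH; rewrite expgS IH.
Qed.

Lemma dyer_gen_braid u v : adj Gamma u v ->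
  \prod_(s <- alternating (edge_label Gamma u v) u v) dyer_gen s =
  \prod_(s <- alternating (edge_label Gamma u v) v u) dyer_gen s.
Proof.
move=> uv; have /pres_eq_rel/word_classP := dyer_rel_braid uv.
by rewrite !word_class_pos.
Qed.

Definition dyer_finite_type : Prop := finite_set dyer_gens.

End Dyer.

Arguments dyer_gens {V} Gamma.

Definition subgroup_generated (G : groupType) (Y : set G) : set G :=
  smallest (fun H : set G => group_closed [in H]) Y.

Definition parabolic (V : choiceType) (Gamma : dyer_graph V)
    (P : set (dyer_group Gamma)) : Prop :=
  exists (Y : set (dyer_group Gamma)) (g : dyer_group Gamma),
    Y `<=` dyer_gens Gamma /\
    P = [set g * h * g^-1 | h in subgroup_generated Y].

(* Main.v *)
Require Import Defs.
From mathcomp Require Import all_boot ssralg ssrint intdiv finmap.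
From mathcomp Require Import boolp classical_sets cardinality.

(** Words are written as products of syllables, a syllable being a power of one
generator, and an occurrence of x_v after a prefix p is recorded by its conjugate
t = p x_v p^-1.  Adding up the exponents recorded at t, modulo the order f(v),
gives a cocycle [cocycle] that depends only on the group element.  Hence a
syllable word with pairwise distinct conjugates and no trivial syllable has
minimal length; conversely, if two conjugates coincide, the two syllables can
be merged.

If d is a shortest element of D_L d D_R, then shortest words of D_L, d and D_R
concatenate to reduced words, and comparing the two sides of a d = d b gives
D_R \cap d^-1 D_L d = D_C with C = {s in R | d s d^-1 in D_L}.  So the
intersection of D_Y with a parabolic subgroup is a D_C a^-1 with a in D_Y and
C \subset Y, and it is D_Y itself when C = Y.  A parabolic subgroup g D_Y g^-1
containing the whole intersection with #|Y| minimal is therefore contained in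
every P_i. *)

Set Implicit Arguments.
Unset Strict Implicit.
Unset Printing Implicit Defensive.

Local Open Scope group_scope.
Local Open Scope quotient_scope.
Local Open Scope classical_set_scope.

(** Decides in which factor of a concatenation a marked syllable [y] lies. *)
Lemma cat_eq_catP (T : Type) (s t u v : seq T) (y : T) : s ++ t = u ++ y :: v ->
  (exists2 w, s = u ++ y :: w & v = w ++ t) \/ (exists w, t = w ++ y :: v).
Proof.
elim: s u => [|a s IH] [|b u] /=; first by right; exists [::].
- by right; exists (b :: u).
- by case=> <- <-; left; exists s.
- case=> <- /IH[[w -> ->]|[w ->]]; first by left; exists w.
  by right; exists w.
Qed.

(** * Generated subgroups and their conjugates *)

Section Generated.
Variables (G : groupType) (Y : set G).

Lemma subgroup_generated_closed : group_closed [in subgroup_generated Y].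
Proof.
split; first by apply/mem_set => H [Hc _]; have [/set_mem] := Hc.
move=> a b /set_mem ha /set_mem hb; apply/mem_set => H [Hc YH].
have [_ cH] := Hc; apply/set_mem; apply: cH; apply/mem_set.
  exact: ha.
exact: hb.
Qed.

Lemma subgroup_generated1 : subgroup_generated Y 1.
Proof. by have [/set_mem] := subgroup_generated_closed. Qed.

Lemma subgroup_generatedV g :
  subgroup_generated Y g -> subgroup_generated Y g^-1.
Proof.
move=> hg; apply/set_mem; apply: (group_closedV subgroup_generated_closed).
exact/mem_set.
Qed.

Lemma subgroup_generatedM g h : subgroup_generated Y g ->
  subgroup_generated Y h -> subgroup_generated Y (g * h).
Proof.
move=> hg hh; apply/set_mem; apply: (group_closedM subgroup_generated_closed);
  exact/mem_set.
Qed.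

Lemma subgroup_generatedX g n :
  subgroup_generated Y g -> subgroup_generated Y (g ^+ n).
Proof.
move=> hg; elim: n => [|n IH]; first exact: subgroup_generated1.
by rewrite expgS; apply: subgroup_generatedM.
Qed.

(** Trades the conjugates in [parabolic] for the notation [k ^ g], which is [g^-1 * k * g]. *)
Lemma conj_setP (H : set G) (g k : G) :
  [set g * h * g^-1 | h in H] k <-> H (k ^ g).
Proof.
split=> [[h Hh <-]|Hk]; last by exists (k ^ g); rewrite -?conjgC ?mulgK.
by rewrite conjgE -!mulgA mulKg mulVg mulg1.
Qed.

End Generated.

Arguments subgroup_generated1 {G} Y.

(** * Exponent counts of words and their invariance *)

Section Dyer.
Variables (V : choiceType) (Gamma : dyer_graph V).
Local Notation D := (dyer_group Gamma).
Local Notation x := (dyer_gen Gamma).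
Local Notation span := subgroup_generated.

(* The value [0] stands for infinite order, so that congruence modulo
   [gen_order v] is equality in that case. *)
Definition gen_order (v : V) : nat := odflt 0 (vertex_label Gamma v).

Lemma dyer_gen_order v : x v ^+ gen_order v = 1.
Proof.
rewrite /gen_order; case fv: (vertex_label Gamma v) => [n|//] /=.
exact: dyer_gen_pow.
Qed.

Definition hit (v : V) (n : nat) (t : D) : int :=
  ((gen_order v == n) && (x v == t))%:Z.

Definition letter_val (a : V * bool) : D := if a.2 then (x a.1)^-1 else x a.1.

Definition word_val (w : word V) : D := word_class (dyer_rel Gamma) w.

Lemma word_val_cat w1 w2 : word_val (w1 ++ w2) = word_val w1 * word_val w2.
Proof. exact: word_class_cat. Qed.

Lemma word_val0 : word_val [::] = 1.
Proof. by []. Qed.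

Lemma word_val1 a : word_val [:: a] = letter_val a.
Proof.
by case: a => v [] //; rewrite /letter_val /=; symmetry; exact: pres_invE.
Qed.

(* The index n separates the contributions of generators of different orders,
   since a priori generators of different orders could be conjugate. *)
Fixpoint crossings (w : word V) (n : nat) (t : D) : int :=
  if w is a :: w' then
    ((if a.2 then - hit a.1 n t else hit a.1 n t)
      + crossings w' n (t ^ letter_val a)%g)%R
  else 0%R.

(** Reading [w2] after [w1] shifts the observed conjugate by the value of [w1]; this becomes the
    cocycle rule. *)
Lemma crossings_cat w1 w2 n t :
  crossings (w1 ++ w2) n t =
  (crossings w1 n t + crossings w2 n (t ^ word_val w1)%g)%R.
Proof.
elim: w1 t => [|a w1 IH] t /=; first by rewrite GRing.add0r word_val0 conjg1.
by rewrite IH GRing.addrA -conjgM -word_val1 -word_val_cat.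
Qed.

Lemma hitJ v n t g : x v ^ g = x v -> hit v n (t ^ g) = hit v n t.
Proof.
by move=> h; rewrite /hit -{1}h (inj_eq (@conjg_inj _ g)).
Qed.

Lemma crossings_pow k v n t :
  crossings (pos_word (nseq k v)) n t = (k%:Z * hit v n t)%R.
Proof.
elim: k t => [|k IH] t /=; first by rewrite GRing.mul0r.
rewrite IH hitJ; first by rewrite intS GRing.mulrDl GRing.mul1r.
by rewrite /letter_val /= conjgE mulKg.
Qed.

Lemma involution_invg v : gen_order v = 2 -> (x v)^-1 = x v.
Proof.
by move=> fv; apply: mulg1_eq; rewrite -expg2 -{1}fv dyer_gen_order.
Qed.

(** Since the generators are involutions, conjugating letter number [j] by the letters before it
    gives the palindrome [(x u * x v) ^+ j * x u]. *)
Lemma crossings_alt m u v t : gen_order u = 2 -> gen_order v = 2 ->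
  crossings (pos_word (alternating m u v)) 2 t =
  (\sum_(j < m) ((x u * x v) ^+ j * x u == t)%g%:Z)%R.
Proof.
elim: m u v t => [|m IH] u v t fu fv /=; first by rewrite big_ord0.
rewrite IH // big_ord_recl /hit fu eqxx /= expg0 mul1g; congr (_ + _)%R.
apply: eq_bigr => j _; congr (Posz (nat_of_bool _)).
rewrite /letter_val /= -(inj_eq (@conjg_inj _ (x u)^-1)) conjgK.
congr (_ == _); rewrite conjgE invgK !mulgA (involution_invg fu).
suff -> : (x u * x v) ^+ j.+1 = x u * (x v * x u) ^+ j * x v by [].
rewrite expgSr !mulgA; congr (_ * _).
elim: (nat_of_ord j) => [|k IHk]; first by rewrite mul1g mulg1.
by rewrite !expgS -mulgA IHk !mulgA.
Qed.

(** Inverting the product over [alternating m v u] reverses it, so that it continues the other one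
    to [2m] letters. The braid relation thus becomes [(x u * x v) ^+ m = 1]. *)
Lemma alternating_quotient m u v :
  gen_order u = 2 -> gen_order v = 2 ->
  \prod_(s <- alternating m u v) x s =
  (x u * x v) ^+ m * \prod_(s <- alternating m v u) x s.
Proof.
move=> fu fv; elim: m => [|m IH] /=; first by rewrite !big_nil mulg1.
have vu : x v * x u = (x u * x v)^-1 by rewrite invgM !involution_invg.
rewrite !big_cons [in RHS]IH expgS -!mulgA; congr (_ * _).
have -> : x v * ((x u * x v) ^+ m * (x v * ((x u * x v) ^+ m *
    \prod_(s <- alternating m v u) x s))) =
    (x u * x v) ^+ m ^ x v * ((x u * x v) ^+ m *
    \prod_(s <- alternating m v u) x s).
  by rewrite conjgE involution_invg // !mulgA.
rewrite conjXg conjgE involution_invg //.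
have -> : x v * (x u * x v * x v) = (x u * x v)^-1.
  by rewrite -vu -[_ * x v * x v]mulgA -{2}(involution_invg fv) mulVg mulg1.
by rewrite expVgn mulKg.
Qed.

Lemma crossings_braid u v n t : adj Gamma u v ->
  (n %| (crossings (pos_word (alternating (edge_label Gamma u v) u v)) n t
     - crossings (pos_word (alternating (edge_label Gamma u v) v u)) n t)%R)%Z.
Proof.
move=> uv.
have := dyer_gen_braid uv.
(* For label 2 the generators commute, so conjugation by one fixes the other and both sides record
   the same two hits. *)
have [m2|/eqP m2] := eqVneq (edge_label Gamma u v) 2.
  rewrite m2 /= !big_cons !big_nil /= !mulg1 => xuv.
  rewrite /= !GRing.addr0 /letter_val /= !hitJ ?conjgE.
  - by rewrite [X in (_ - X)%R]GRing.addrC GRing.subrr dvdz0.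
  - by rewrite xuv mulKg.
  - by rewrite -xuv mulKg.
(* Both generators are now involutions, so only [n = 2] can record anything. *)
have [fu fv] := edge_label_neq2 uv m2.
have {}fu : gen_order u = 2 by rewrite /gen_order fu.
have {}fv : gen_order v = 2 by rewrite /gen_order fv.
set m := edge_label _ _ _ => xuv.
have uvm : (x u * x v) ^+ m = 1.
  move: xuv; rewrite (alternating_quotient _ fu fv).
  by rewrite -[RHS]mul1g => /mulIg.
have [->|n2] := eqVneq n 2; last first.
  suff c0 k a b s : gen_order a = 2 -> gen_order b = 2 ->
      crossings (pos_word (alternating k a b)) n s = 0%R.
    by rewrite !c0 // GRing.subrr dvdz0.
  elim: k a b s => [//|k IH] a b s fa fb /=; rewrite IH // GRing.addr0.
  by rewrite /hit fa eq_sym (negbTE n2).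
(* As (x_u x_v)^m = 1, the two sides list the same conjugates in opposite orders. *)
rewrite !crossings_alt // [X in (X - _)%R](reindex_inj rev_ord_inj) /=.
rewrite [X in (X - _)%R](eq_bigr (fun j : 'I_m =>
    ((x v * x u) ^+ j * x v == t)%g%:Z)%R).
  by rewrite GRing.subrr dvdz0.
move=> j _; congr (Posz (nat_of_bool (_ == _))).
have vu : x v * x u = (x u * x v)^-1 by rewrite invgM !involution_invg.
rewrite expgnFr // uvm mul1g -expVgn -vu expgSr -!mulgA.
by rewrite -{3}(involution_invg fu) mulgV mulg1.
Qed.

Lemma crossings_pres_eq w1 w2 n t : pres_eq (dyer_rel Gamma) w1 w2 ->
  (n %| (crossings w1 n t - crossings w2 n t)%R)%Z.
Proof.
move=> w12; elim: w12 t => {w1 w2}.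
- move=> l r [v k fv|u v uv] t; last exact: crossings_braid.
  (* The hit vanishes unless [n] is the order [k], and then the count is a multiple of [n]. *)
  rewrite crossings_pow /= GRing.subr0 /hit /gen_order fv /=.
  case: eqP => [->|_]; last by rewrite GRing.mulr0 dvdz0.
  by rewrite dvdz_mulr // dvdzz.
- move=> [v b] t /=; rewrite /letter_val /=.
  have xJ : x v ^ x v = x v by rewrite conjgE mulKg.
  have xVJ : x v ^ (x v)^-1 = x v by rewrite -{1}xJ conjgK.
  case: b => /=; rewrite hitJ // GRing.addr0 GRing.subr0.
    by rewrite GRing.addNr dvdz0.
  by rewrite GRing.subrr dvdz0.
- by move=> w t; rewrite GRing.subrr dvdz0.
- by move=> w1 w2 _ IH t; rewrite -GRing.opprB GRing.rpredN.
- move=> w1 w2 w3 _ IH1 _ IH2 t.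
  by rewrite -(GRing.subrKA (crossings w2 n t)) GRing.rpredD.
- move=> w1 w1' w2 w2' e1 IH1 _ IH2 t.
  rewrite !crossings_cat GRing.opprD GRing.addrACA GRing.rpredD //.
  have -> : word_val w1 = word_val w1' by apply/word_classP.
  exact: IH2.
Qed.

(** The count is taken on a chosen representative, so only its residue modulo [n] is meaningful. *)
Definition cocycle (g : D) (n : nat) (t : D) : int := crossings (repr g) n t.

Lemma cocycle_word w n t :
  (n %| (cocycle (word_val w) n t - crossings w n t)%R)%Z.
Proof. by apply: crossings_pres_eq; exact: pres_eq_repr. Qed.

Lemma cocycleM g h n t :
  (n %| (cocycle (g * h)%g n t - (cocycle g n t + cocycle h n (t ^ g)%g))%R)%Z.
Proof.
have valK (k : D) : word_val (repr k) = k by rewrite /word_val /word_class reprK.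
by have := cocycle_word (repr g ++ repr h) n t;
  rewrite word_val_cat crossings_cat !valK.
Qed.

(** * Powers of a single generator *)

Lemma crossings_powV k v n (t : D) :
  crossings (nseq k (v, true)) n t = (- (k%:Z * hit v n t))%R.
Proof.
elim: k t => [|k IH] t /=; first by rewrite GRing.mul0r GRing.oppr0.
rewrite IH hitJ; first by rewrite intS GRing.mulrDl GRing.mul1r GRing.opprD.
by rewrite /letter_val /= conjgE invgK mulgA mulgK.
Qed.

(** The cyclic subgroup of [x v]; a quotient of two powers covers negative exponents, as [^+] takes
    natural ones. *)
Definition cyc (v : V) (h : D) : Prop :=
  exists m1 m2 : nat, h = x v ^+ m1 / x v ^+ m2.

Lemma cyc_gen v : cyc v (x v).
Proof. by exists 1%N, 0%N; rewrite expg0 divg1. Qed.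

Lemma cycM v g h : cyc v g -> cyc v h -> cyc v (g * h).
Proof.
move=> [a [b ->]] [c [d ->]]; exists (a + c), (d + b).
rewrite !expgnDr invgM -!mulgA; congr (_ * _); rewrite !mulgA; congr (_ / _).
have cm i j : commute (x v ^+ i) (x v ^+ j) by apply: commuteX2.
by rewrite (commute_sym (commuteV (cm c b))).
Qed.

Lemma cycV v h : cyc v h -> cyc v h^-1.
Proof. by move=> [a [b ->]]; exists b, a; rewrite invgF. Qed.

Lemma cycJ u v g h : x v = x u ^ g -> cyc u h -> cyc v (h ^ g).
Proof.
by move=> e [a [b ->]]; exists a, b; rewrite conjMg conjVg !conjXg e.
Qed.

Lemma cyc_fix v h : cyc v h -> x v ^ h = x v.
Proof.
move=> [a [b ->]]; apply/conjg_fixP/commgP.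
by apply: commuteM; [|apply: commuteV]; apply: commuteX.
Qed.

Lemma cocycle_cyc v a b n t :
  (n %| (cocycle (x v ^+ a / x v ^+ b)%g n t
         - (a%:Z - b%:Z) * hit v n t)%R)%Z.
Proof.
have pw k c : word_val (nseq k (v, c)) = letter_val (v, c) ^+ k.
  elim: k => [//|k IH]; rewrite expgS -IH -(word_val1 (v, c)).
  by rewrite -word_val_cat.
have := cocycle_word (nseq a (v, false) ++ nseq b (v, true)) n t.
rewrite word_val_cat !pw crossings_cat pw crossings_powV hitJ; last first.
  by apply: cyc_fix; exists a, 0%N; rewrite expg0 divg1.
have -> : nseq a (v, false) = pos_word (nseq a v) by rewrite /pos_word map_nseq.
by rewrite crossings_pow /letter_val /= expVgn GRing.mulrBl.
Qed.

Lemma cocycle_cyc_out v h n t : cyc v h ->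
  ~~ ((gen_order v == n) && (x v == t)) -> (n %| cocycle h n t)%Z.
Proof.
move=> [a [b ->]] /negbTE h0; have := cocycle_cyc v a b n t.
by rewrite /hit h0 GRing.mulr0 GRing.subr0.
Qed.

(** At its own generator the count is the exponent, so it detects nontrivial syllables; for infinite
    order, divisibility by 0 says that the exponent is 0. *)
Lemma cocycle_cyc_eq1 v h : cyc v h ->
  (gen_order v %| cocycle h (gen_order v) (x v))%Z -> h = 1.
Proof.
move=> [a [b ->]] h0; have := cocycle_cyc v a b (gen_order v) (x v).
rewrite GRing.rpredBl // /hit !eqxx GRing.mulr1.
(* Inversion swaps the two exponents, so their difference may be taken nonnegative. *)
wlog ab : a b {h0} / b <= a => [H|].
  have [|/ltnW] := leqP b a; first exact: H.
  move=> ab; rewrite -GRing.opprB GRing.rpredN => /(H _ _ ab) /(congr1 inv).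
  by rewrite invgF invg1.
rewrite subzn // dvdzE !absz_nat => /dvdnP[k e]; rewrite -expgnFr // e mulnC expgnA.
by rewrite dyer_gen_order expg1n.
Qed.

Lemma dvdz_subr (n a b : int) : (n %| (a - b)%R)%Z -> (n %| a)%Z = (n %| b)%Z.
Proof. by move=> nab; rewrite -[in LHS](GRing.subrK b a) GRing.rpredDl. Qed.

Lemma cocycleMl g h n (t : D) : (n %| cocycle h n (t ^ g)%g)%Z ->
  (n %| cocycle (g * h)%g n t)%Z = (n %| cocycle g n t)%Z.
Proof. by move=> h0; rewrite (dvdz_subr (cocycleM g h n t)) GRing.rpredDr. Qed.

Lemma cocycleMr g h n (t : D) : (n %| cocycle g n t)%Z ->
  (n %| cocycle (g * h)%g n t)%Z = (n %| cocycle h n (t ^ g)%g)%Z.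
Proof. by move=> g0; rewrite (dvdz_subr (cocycleM g h n t)) GRing.rpredDl. Qed.

Lemma cocycle1 n (t : D) : (n %| cocycle 1%g n t)%Z.
Proof. by have := cocycle_word [::] n t; rewrite word_val0 GRing.subr0. Qed.

(** * Syllable words, their conjugates and reducedness *)

(* A syllable is a pair (v, h) where h lies in the subgroup generated by x_v. *)
Definition syll_val (w : seq (V * D)) : D := \prod_(y <- w) y.2.

Lemma syll_val_nil : syll_val [::] = 1.
Proof. by rewrite /syll_val big_nil. Qed.

Lemma syll_val_cons y w : syll_val (y :: w) = y.2 * syll_val w.
Proof. by rewrite /syll_val big_cons. Qed.

Lemma syll_val_cat w1 w2 : syll_val (w1 ++ w2) = syll_val w1 * syll_val w2.
Proof. by rewrite /syll_val big_cat. Qed.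

Definition syll_over (Y : set D) (w : seq (V * D)) : Prop :=
  forall y, y \in w -> Y (x y.1) /\ cyc y.1 y.2.

Lemma syll_over_cons Y y w :
  syll_over Y (y :: w) <-> (Y (x y.1) /\ cyc y.1 y.2) /\ syll_over Y w.
Proof.
split=> [h|[hy hw] z].
  by split=> [|z zw]; apply: h; rewrite inE ?eqxx ?zw ?orbT.
by rewrite inE => /orP[/eqP ->|/hw].
Qed.

Lemma syll_over_cat Y w1 w2 :
  syll_over Y (w1 ++ w2) <-> syll_over Y w1 /\ syll_over Y w2.
Proof.
split=> [h|[h1 h2] z]; last by rewrite mem_cat => /orP[/h1|/h2].
by split=> z zw; apply: h; rewrite mem_cat zw ?orbT.
Qed.

(** As [t ^ y.2^-1] is [y.2 * t * y.2^-1], each generator is conjugated by the prefix before it; for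
    Coxeter groups these are the reflections attached to a word. *)
Fixpoint refls (w : seq (V * D)) : seq D :=
  if w is y :: w' then x y.1 :: [seq t ^ y.2^-1 | t <- refls w'] else [::].

Lemma size_refls w : size (refls w) = size w.
Proof. by elim: w => [//|y w IH] /=; rewrite size_map IH. Qed.

Lemma refls_cat w1 w2 :
  refls (w1 ++ w2) = refls w1 ++ [seq t ^ (syll_val w1)^-1 | t <- refls w2].
Proof.
elim: w1 => [|y w1 IH] /=.
  by rewrite syll_val_nil invg1 -[LHS]map_id; apply: eq_map => t; rewrite conjg1.
rewrite IH map_cat -map_comp; congr (_ :: _ ++ _); apply: eq_map => t /=.
by rewrite syll_val_cons invgM conjgM.
Qed.

Lemma refls_split w t : t \in refls w ->
  exists w1 y w2, w = w1 ++ y :: w2 /\ t = x y.1 ^ (syll_val w1)^-1.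
Proof.
elim: w t => [//|y w IH] t /=; rewrite inE => /orP[/eqP ->|/mapP[s /IH]].
  by exists [::], y, w; rewrite syll_val_nil invg1 conjg1.
move=> [w1 [z [w2 [-> ->]]]] ->; exists (y :: w1), z, w2; split=> //.
by rewrite syll_val_cons invgM conjgM.
Qed.

Lemma cocycle_notin_refls w n t : syll_over setT w -> t \notin refls w ->
  (n %| cocycle (syll_val w) n t)%Z.
Proof.
elim: w t => [|y w IH] t /=; first by rewrite syll_val_nil cocycle1.
move=> /syll_over_cons[[_ cy] ov]; rewrite inE negb_or => /andP[ty tw].
rewrite syll_val_cons cocycleMr.
  apply: IH => //; apply: contra tw => tw; apply/mapP.
  by exists (t ^ y.2); rewrite ?conjgK.
by apply: cocycle_cyc_out cy _; rewrite [x _ == _]eq_sym negb_and ty orbT.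
Qed.

Definition reduced (w : seq (V * D)) : Prop :=
  [/\ syll_over setT w, uniq (refls w) & {in w, forall y, y.2 <> 1}].

(** The conjugates being distinct, only one syllable contributes at [t]; it is nontrivial, so its
    count survives modulo its order. *)
Lemma cocycle_in_refls w t : reduced w -> t \in refls w ->
  exists n : nat, ~~ (n %| cocycle (syll_val w) n t)%Z.
Proof.
elim: w t => [//|y w IH] t [/syll_over_cons[[_ cy] ov] /= /andP[yw uw] nt].
have yJ := cyc_fix cy.
have {}uw : uniq (refls w) by move: uw; rewrite map_inj_uniq //; exact: conjg_inj.
rewrite inE; have [-> _|ty] := eqVneq t (x y.1).
  exists (gen_order y.1); rewrite syll_val_cons cocycleMl.
    apply/negP => /(cocycle_cyc_eq1 cy); apply: nt; exact: mem_head.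
  (* [x y.1] is fixed by [y.2], so an occurrence in [refls w] would repeat it in the whole word. *)
  apply: cocycle_notin_refls => //; apply: contra yw; rewrite yJ => yw.
  by apply/mapP; exists (x y.1) => //; rewrite -{2}yJ conjgK.
move=> /= /mapP[s sw ts].
have [|n sn] := IH s _ sw.
  by split=> // z zw; apply: nt; rewrite inE zw orbT.
exists n; rewrite syll_val_cons cocycleMr ?ts ?conjgKV //.
by apply: cocycle_cyc_out cy _; rewrite -ts [x _ == _]eq_sym negb_and ty orbT.
Qed.

(** Every conjugate of [w] is seen by the cocycle, hence occurs in any other word for the same
    element. *)
Lemma reduced_size w w' : reduced w -> syll_over setT w' ->
  syll_val w = syll_val w' -> size w <= size w'.
Proof.
move=> rw ov e; rewrite -(size_refls w) -(size_refls w').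
apply: uniq_leq_size; first by case: rw.
move=> t /(cocycle_in_refls rw)[n]; rewrite e; apply: contraNT.
exact: cocycle_notin_refls.
Qed.

(** After cancelling the prefix [u1], a coincidence across the two factors says that the stretch
    between [y] and [z] conjugates [x y.1] to [x z.1]; [y.2] itself drops out, as it commutes with
    [x y.1]. *)
Lemma reduced_cat w1 w2 : reduced w1 -> reduced w2 ->
  (forall u1 y v1 u2 z v2, w1 = u1 ++ y :: v1 -> w2 = u2 ++ z :: v2 ->
    x z.1 <> x y.1 ^ (syll_val v1 * syll_val u2)) ->
  reduced (w1 ++ w2).
Proof.
move=> [o1 uniq1 nt1] [o2 uniq2 nt2] h; split.
- exact/syll_over_cat.
- rewrite refls_cat cat_uniq uniq1 map_inj_uniq ?uniq2 ?andbT /=; last first.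
    exact: conjg_inj.
  apply/hasPn => t /mapP[s /refls_split[u2 [z [v2 [ew2 ->]]]] ->].
  apply/negP => /refls_split[u1 [y [v1 [ew1 e]]]].
  have [_ cy] : setT (x y.1) /\ cyc y.1 y.2.
    by apply: o1; rewrite ew1 mem_cat mem_head orbT.
  apply: (h _ _ _ _ _ _ ew1 ew2).
  have ey : x y.1 = x z.1 ^ ((syll_val w1 * syll_val u2)^-1 * syll_val u1).
    by rewrite invgM !conjgM e conjgKV.
  rewrite -(cyc_fix cy) -conjgM ey -conjgM ew1 syll_val_cat syll_val_cons.
  by rewrite -!mulgA mulVg conjg1.
- by move=> y; rewrite mem_cat => /orP[/nt1|/nt2].
Qed.

Lemma reduced_syll (y : V * D) :
  cyc y.1 y.2 -> y.2 <> 1 -> reduced [:: y].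
Proof. by move=> cy ny; split=> // z; rewrite inE => /eqP ->. Qed.

Lemma subgroup_generated_cyc (Y : set D) v h : Y (x v) -> cyc v h -> span Y h.
Proof.
move=> Yv [a [b ->]].
have hv : span Y (x v) by exact: sub_gen_smallest.
by apply: subgroup_generatedM; [|apply: subgroup_generatedV];
  exact: subgroup_generatedX.
Qed.

Lemma subgroup_generatedP (Y : set D) g : Y `<=` dyer_gens Gamma ->
  span Y g <-> exists w, syll_over Y w /\ syll_val w = g.
Proof.
move=> YX; split; last first.
  move=> [w [+ <-]]; elim: w => [|y w IH].
    by rewrite syll_val_nil => _; exact: subgroup_generated1.
  move=> /syll_over_cons[[Yy cy] ov]; rewrite syll_val_cons.
  by apply: subgroup_generatedM; [exact: subgroup_generated_cyc cy|exact: IH].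
move: g; apply: smallest_sub; last first.
  move=> s Ys; have [v _ vs] := YX s Ys; rewrite -vs in Ys *.
  exists [:: (v, x v)]; rewrite syll_val_cons syll_val_nil mulg1; split=> //.
  by apply/syll_over_cons; split=> //; split=> //; exact: cyc_gen.
split; first by apply/mem_set; exists [::]; rewrite syll_val_nil.
move=> _ _ /set_mem[w1 [o1 <-]] /set_mem[w2 [o2 <-]]; apply/mem_set.
have [w [ow ew]] : exists w, syll_over Y w /\ syll_val w = (syll_val w2)^-1.
  elim: w2 o2 => [|y w2 IH]; first by exists [::]; rewrite syll_val_nil invg1.
  move=> /syll_over_cons[[Yy cy] /IH[w [ow ew]]].
  exists (w ++ [:: (y.1, y.2^-1)]); split.
    apply/syll_over_cat; split=> //; apply/syll_over_cons; split=> //.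
    by split=> //; exact: cycV.
  by rewrite syll_val_cat !syll_val_cons syll_val_nil mulg1 ew invgM.
exists (w1 ++ w); rewrite syll_val_cat ew; split=> //.
exact/syll_over_cat.
Qed.

(** * Shortest words over a set of generators *)

Lemma shortest_word (P : seq (V * D) -> Prop) : (exists w, P w) ->
  exists w, P w /\ forall w', P w' -> size w <= size w'.
Proof.
move=> [w0 Pw0].
have ex : exists n, `[< exists w, P w /\ size w = n >].
  by exists (size w0); apply/asboolP; exists w0.
case: (ex_minnP ex) => n /asboolP[w [Pw <-]] wmin.
by exists w; split=> // w' Pw'; apply: wmin; apply/asboolP; exists w'.
Qed.

(** When two syllables share a conjugate, the right one can be carried across the stretch [b] and
    absorbed on the left. *)
Lemma cyc_shift (y z : V * D) (b : D) : x z.1 = x y.1 ^ b -> cyc z.1 z.2 ->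
  exists2 c : D, cyc y.1 c & b * z.2 = c * b.
Proof.
move=> e cz; exists (z.2 ^ b^-1); last by rewrite -conjgCV.
by apply: cycJ cz; rewrite e conjgK.
Qed.

Definition shortest (Y : set D) w : Prop := syll_over Y w /\
  forall w', syll_over Y w' -> syll_val w' = syll_val w -> size w <= size w'.

Lemma subgroup_generated_shortest (Y : set D) g : Y `<=` dyer_gens Gamma ->
  span Y g -> exists w, shortest Y w /\ syll_val w = g.
Proof.
move=> YX /(subgroup_generatedP _ YX) /shortest_word[w [[ov <-] wmin]].
by exists w; split=> //; split=> // w' ov' ew'; apply: wmin.
Qed.

(** By induction only the first syllable can clash with a later one; merging that one into it stays
    over [Y] and saves a syllable. *)
Lemma shortest_reduced (Y : set D) w : shortest Y w -> reduced w.
Proof.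
elim: w => [//|y w IH] [/syll_over_cons[[Yy cy] ov] wmin].
have {IH} rw : reduced w.
  apply: IH; split=> // w' ov' ew'.
  have := wmin (y :: w'); rewrite !syll_val_cons ew' => H.
  by rewrite -ltnS; apply: H => //; apply/syll_over_cons.
rewrite -cat1s; apply: reduced_cat => //.
  apply: reduced_syll => // y1; have := wmin w ov.
  by rewrite syll_val_cons y1 mul1g ltnn => /(_ erefl).
case=> [|? []] // _ _ u2 z v2 [<- <-] ew; rewrite syll_val_nil mul1g => ez.
rewrite ew in ov wmin; have /syll_over_cat[ov1 /syll_over_cons[[Yz cz] ov2]] := ov.
have [c cc ec] := cyc_shift ez cz.
suff : size (y :: u2 ++ z :: v2) <= size ((y.1, y.2 * c) :: u2 ++ v2).
  by rewrite /= !size_cat /= addnS ltnn.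
apply: wmin.
  apply/syll_over_cons; split; last exact/syll_over_cat.
  by split=> //; exact: cycM.
rewrite !(syll_val_cons, syll_val_cat) /= -!mulgA; congr (_ * _).
by rewrite mulgA -ec !mulgA.
Qed.

(** * Shortest representatives of double cosets *)

Section DoubleCoset.
Variables (L R : set D) (d : seq (V * D)).
Hypotheses (LX : L `<=` dyer_gens Gamma) (RX : R `<=` dyer_gens Gamma).
Hypothesis dX : syll_over setT d.
Hypothesis dmin : forall a b w, span L a -> span R b -> syll_over setT w ->
  syll_val w = a * syll_val d * b -> size d <= size w.

Lemma double_coset_reduced : reduced d.
Proof.
apply: (@shortest_reduced setT); split=> // w ow ew.
apply: (dmin (subgroup_generated1 L) (subgroup_generated1 R) ow).
by rewrite mul1g mulg1.
Qed.

(** Otherwise [d] without [z] would be a shorter word in the same double coset. *)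
Lemma double_coset_dropL (w1 : seq (V * D)) z w2 a : d = w1 ++ z :: w2 ->
  span L a -> a * syll_val d <> syll_val (w1 ++ w2).
Proof.
move=> ed La e; have ov : syll_over setT (w1 ++ w2).
  move: dX; rewrite ed => /syll_over_cat[o1 /syll_over_cons[_ o2]].
  exact/syll_over_cat.
have := dmin La (subgroup_generated1 R) ov; rewrite e mulg1 ed.
by rewrite !size_cat /= addnS ltnn => /(_ erefl).
Qed.

Lemma double_coset_dropR (w1 : seq (V * D)) z w2 b : d = w1 ++ z :: w2 ->
  span R b -> syll_val d * b <> syll_val (w1 ++ w2).
Proof.
move=> ed Rb e; have ov : syll_over setT (w1 ++ w2).
  move: dX; rewrite ed => /syll_over_cat[o1 /syll_over_cons[_ o2]].
  exact/syll_over_cat.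
have := dmin (subgroup_generated1 L) Rb ov; rewrite -mulgA e mul1g ed.
by rewrite !size_cat /= addnS ltnn => /(_ erefl).
Qed.

(** A clash would let [z] be carried left through [u2] and absorbed into D_L, dropping it from
    [d]. *)
Lemma double_coset_catl w : shortest L w -> reduced (w ++ d).
Proof.
move=> sw; have [ov _] := sw; apply: reduced_cat.
- exact: shortest_reduced sw.
- exact: double_coset_reduced.
move=> u1 y v1 u2 z v2 ew ed ez.
rewrite ew in ov; have /syll_over_cat[o1 /syll_over_cons[[Ly cy] o2]] := ov.
have cz : cyc z.1 z.2.
  by have [] := dX (y := z); rewrite // ed mem_cat mem_head orbT.
have [c cc ec] := cyc_shift ez cz.
have Lv : span L (syll_val v1) by apply/subgroup_generatedP => //; exists v1.
(* In terms of values, [u2 * z.2 = (v1^-1 * c * v1) * u2], so this element of D_L cancels the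
   syllable [z]. *)
apply: (double_coset_dropL (a := (syll_val v1)^-1 * c^-1 * syll_val v1) ed).
  apply: subgroup_generatedM => //; apply: subgroup_generatedM.
    exact: subgroup_generatedV.
  by apply: subgroup_generatedV; apply: subgroup_generated_cyc Ly cc.
have e : z.2 = (syll_val v1 * syll_val u2)^-1 * (c * (syll_val v1 * syll_val u2)).
  by rewrite -ec mulKg.
by rewrite ed !syll_val_cat syll_val_cons e invgM -!mulgA !mulVKg !mulKg.
Qed.

(** The mirror image: a clashing syllable [y] of [d] is carried right and absorbed into D_R. *)
Lemma double_coset_catr w : shortest R w -> reduced (d ++ w).
Proof.
move=> sw; have [ov _] := sw; apply: reduced_cat.
- exact: double_coset_reduced.
- exact: shortest_reduced sw.
move=> u1 y v1 u2 z v2 ed ew ez.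
rewrite ew in ov; have /syll_over_cat[o1 /syll_over_cons[[Rz cz] o2]] := ov.
have cy : cyc y.1 y.2.
  by have [] := dX (y := y); rewrite // ed mem_cat mem_head orbT.
have cc : cyc z.1 (y.2 ^ (syll_val v1 * syll_val u2)) by apply: cycJ cy.
have Ru : span R (syll_val u2) by apply/subgroup_generatedP => //; exists u2.
apply: (double_coset_dropR (b := syll_val u2 *
    (y.2 ^ (syll_val v1 * syll_val u2))^-1 * (syll_val u2)^-1) ed).
  apply: subgroup_generatedM; last exact: subgroup_generatedV.
  apply: subgroup_generatedM => //.
  by apply: subgroup_generatedV; apply: subgroup_generated_cyc Rz cc.
rewrite ed !syll_val_cat syll_val_cons conjgE !invgM invgK -!mulgA.
by rewrite !mulVKg mulVg mulg1.
Qed.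

(** Induction on a shortest word for [b]: the last syllable [z] is peeled off once its generator is
    known to be conjugated into D_L. *)
Lemma double_coset_inter b : span R b -> span L (b ^ (syll_val d)^-1) ->
  span [set s | R s /\ span L (s ^ (syll_val d)^-1)] b.
Proof.
move=> Rb; have [w [sw <-]] := subgroup_generated_shortest RX Rb; clear b Rb.
elim/last_ind: w sw => [|w z IH] sw Lb.
  by rewrite syll_val_nil; exact: subgroup_generated1.
have rdw := double_coset_catr sw.
have [a [sa ea]] := subgroup_generated_shortest LX Lb.
have rad := double_coset_catl sa.
rewrite -cats1 in sw rdw Lb ea *.
have /syll_over_cat[ow /syll_over_cons[[Rz cz] _]] := sw.1.
have sw' : shortest R w.
  split=> // w' ow' ew'; have := sw.2 (w' ++ [:: z]).
  rewrite !size_cat !addn1 ltnS !syll_val_cat ew'; apply=> //.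
  by apply/syll_over_cat; split=> //; apply/syll_over_cons.
have nz : z.2 <> 1.
  by have [_ _] := shortest_reduced sw; apply; rewrite mem_cat mem_head orbT.
have Lz : span L (x z.1 ^ (syll_val d)^-1).
  have [//|Lz] := pselect (span L (x z.1 ^ (syll_val d)^-1)).
  (* Otherwise [a ++ d ++ z^-1] and [d ++ w] spell the same element, whereas
     reducedness of both sides of [a d = d w z] forces contradictory lengths. *)
  have /reduced_size : reduced ((a ++ d) ++ [:: (z.1, z.2^-1)]).
    apply: reduced_cat => //.
      apply: reduced_syll => /=; first exact: cycV.
      by move/eqP; rewrite invg_eq1 => /eqP.
    move=> u1 y v1 [|? []] // _ _ eu [<- _].
    rewrite syll_val_nil mulg1 /=.
    (* A clash with a syllable of [a] puts the conjugate of [x z.1] in D_L; one with a syllable of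
       [d] lets that syllable be absorbed into D_R. *)
    have [[v ea' ->]|[u {}eu]] := cat_eq_catP eu => ez.
      apply: Lz; rewrite ez syll_val_cat conjgM conjgK.
      have := sa.1; rewrite ea' => /syll_over_cat[_ /syll_over_cons[[Ly _] ov]].
      have Lv : span L (syll_val v) by apply/subgroup_generatedP => //; exists v.
      rewrite conjgE; apply: subgroup_generatedM; first exact: subgroup_generatedV.
      apply: subgroup_generatedM => //; exact: sub_gen_smallest.
    have cy : cyc y.1 y.2.
      by have [] := dX (y := y); rewrite // eu mem_cat mem_head orbT.
    apply: (double_coset_dropR (b := (y.2 ^ syll_val v1)^-1) eu).
      apply: subgroup_generatedV; apply: (subgroup_generated_cyc Rz).
      exact: cycJ cy.
    by rewrite eu !syll_val_cat syll_val_cons conjgE !invgM invgK -!mulgA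
      !mulVKg.
  have ov : syll_over setT (d ++ w).
    by apply/syll_over_cat; split=> // y /ow[].
  have ov' : syll_over setT (a ++ d) by apply/syll_over_cat; split=> // y /sa.1[].
  move=> /(_ _ ov); rewrite !syll_val_cat !syll_val_cons syll_val_nil ea /=.
  rewrite syll_val_cat syll_val_cons syll_val_nil !mulg1 -conjgCV.
  rewrite -!mulgA mulgV mulg1.
  move=> /(_ erefl) lt_ad; have := reduced_size rdw ov'.
  rewrite !syll_val_cat ea -conjgCV syll_val_cat => /(_ erefl) lt_dw.
  rewrite !size_cat !addnA !addn1 in lt_ad lt_dw.
  by have := ltn_trans lt_dw lt_ad; rewrite ltnn.
have Rz' : span [set s | R s /\ span L (s ^ (syll_val d)^-1)] z.2.
  by apply: subgroup_generated_cyc cz.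
rewrite syll_val_cat syll_val_cons syll_val_nil mulg1.
apply: subgroup_generatedM => //; apply: IH => //.
rewrite -(mulgK z.2 (syll_val w)) conjMg.
apply: subgroup_generatedM.
  by rewrite syll_val_cat syll_val_cons syll_val_nil mulg1 in Lb.
rewrite conjVg; apply: subgroup_generatedV.
have [m1 [m2 ->]] := cz; rewrite conjMg conjVg !conjXg.
by apply: subgroup_generatedM; [|apply: subgroup_generatedV];
  exact: subgroup_generatedX.
Qed.

End DoubleCoset.

(** * Intersecting with a conjugate of a standard parabolic subgroup *)

Lemma exists_syll_word (g : D) : exists w, syll_over setT w /\ syll_val w = g.
Proof.
elim/word_class_ind: g => w; rewrite -/(word_val w).
elim: w => [|a w [w' [ov ew]]]; first by exists [::]; rewrite syll_val_nil.
exists ((a.1, letter_val a) :: w'); split.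
  apply/syll_over_cons; split=> //; split=> //=; rewrite /letter_val.
  by case: a.2; [apply: cycV|]; exact: cyc_gen.
by rewrite syll_val_cons ew -word_val1 -word_val_cat.
Qed.

(** With [d = a * g^-1 * b] shortest in D_Z g^-1 D_Y, conjugation by [b] preserves D_Y and turns the
    condition on [k ^ g] into one on conjugates by [d]. The conjugator returned is this [b]. *)
Lemma subgroup_generated_inter_conj (Y Z : set D) g :
  Y `<=` dyer_gens Gamma -> Z `<=` dyer_gens Gamma ->
  exists a C, [/\ span Y a, C `<=` Y &
    forall k, span Y k /\ span Z (k ^ g) <-> span C (k ^ a)].
Proof.
move=> YX ZX.
have [|d [[ov [a [b [Za Yb ed]]] dmin]]] := @shortest_word
    (fun w => syll_over setT w /\
      exists a b, [/\ span Z a, span Y b & syll_val w = a * g^-1 * b]).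
  have [w [ov ew]] := exists_syll_word g^-1.
  exists w; split=> //; exists 1, 1; rewrite mul1g mulg1.
  by split=> //; exact: subgroup_generated1.
have dgb : g^-1 = a^-1 * syll_val d * b^-1 by rewrite ed -!mulgA mulKg mulgV mulg1.
pose C := [set s | Y s /\ span Z (s ^ (syll_val d)^-1)].
have CZ : span C `<=` [set c | span Z (c ^ (syll_val d)^-1)].
  apply: smallest_sub => [|s []//]; split.
    by apply/mem_set; rewrite /= conj1g; exact: subgroup_generated1.
  move=> s t /set_mem Zs /set_mem Zt; apply/mem_set; rewrite /= conjMg conjVg.
  by apply: subgroup_generatedM => //; exact: subgroup_generatedV.
have CY : C `<=` Y by move=> s [].
have memZ k : span Z (k ^ g) <-> span Z ((k ^ b) ^ (syll_val d)^-1).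
  have -> : k ^ g = ((k ^ b) ^ (syll_val d)^-1) ^ a.
    by rewrite -!conjgM -[g]invgK dgb !invgM !invgK ?mulgA.
  rewrite conjgE; split=> [Zk|Zk].
    have := subgroup_generatedM (subgroup_generatedM Za Zk) (subgroup_generatedV Za).
    by rewrite mulVKg mulgK.
  apply: subgroup_generatedM; first exact: subgroup_generatedV.
  exact: subgroup_generatedM.
have memY k : span Y k <-> span Y (k ^ b).
  split=> [Yk|].
    rewrite conjgE; apply: subgroup_generatedM; first exact: subgroup_generatedV.
    exact: subgroup_generatedM.
  move=> Yk.
  have := subgroup_generatedM (subgroup_generatedM Yb Yk) (subgroup_generatedV Yb).
  by rewrite conjgE mulVKg mulgK.
exists b, C; split=> // k; split.
  move=> [/memY Yk /memZ Zk]; apply: (double_coset_inter ZX YX ov _ Yk Zk).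
  move=> a' b' w Za' Yb' ow ew; apply: dmin; split=> //.
  exists (a' * a), (b * b'); split; [exact: subgroup_generatedM..|].
  by rewrite ew ed !mulgA.
move=> Ck; split; last by apply/memZ; exact: CZ.
apply/memY; move: Ck; apply: smallest_sub => [|s /CY Ys].
  exact: subgroup_generated_closed.
exact: sub_gen_smallest.
Qed.

End Dyer.

Theorem theorem2p10 (V : choiceType) (Gamma : dyer_graph V)
  (finX : dyer_finite_type Gamma)
  (I : Type) (nonemptyI : [set: I] !=set0)
  (P : I -> set (dyer_group Gamma))
  (parP : forall i, parabolic (P i)) :
  parabolic (\bigcap_i P i).
Proof.
(* Some [P i] itself contains the intersection, so a smallest size of [Y] exists. *)
have ex : exists n, `[< exists Y g, [/\ Y `<=` dyer_gens Gamma,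
    \bigcap_i P i `<=` [set g * h * g^-1 | h in subgroup_generated Y] &
    #|` fset_set Y| = n] >].
  have [i _] := nonemptyI; have [Y [g [YX Pi]]] := parP i.
  exists #|` fset_set Y|; apply/asboolP; exists Y, g; split=> //.
  by rewrite -Pi; exact: bigcap_inf.
case: (ex_minnP ex) => n /asboolP[Y [g [YX PY <-]]] Ymin.
exists Y, g; split=> //; apply/seteqP; split=> // k /conj_setP Yk i _.
have [Z [h [ZX Pi]]] := parP i.
have [a [C [Ya CY inter]]] := subgroup_generated_inter_conj (g^-1 * h) YX ZX.
(* [fset_set] of an infinite set is empty by default; finite type makes the cardinals genuine. *)
have finY : finite_set Y by apply: sub_finite_set finX.
have finC : finite_set C by apply: sub_finite_set finY.
have -> : P i = [set h * t * h^-1 | t in subgroup_generated Z] by [].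
(* [g * a] and [C] give another parabolic subgroup containing the intersection, with [C] inside [Y],
   so minimality forces equality. *)
have CE : C = Y.
  have : fset_set C == fset_set Y.
    have sub : (fset_set C `<=` fset_set Y)%fset by rewrite -fset_set_sub.
    rewrite eqEfcard sub; apply: Ymin; apply/asboolP.
    exists C, (g * a); split=> //; first exact: subset_trans YX.
    move=> t Pt; apply/conj_setP; rewrite conjgM; apply/inter.
    split; first by apply/conj_setP; exact: PY.
    rewrite conjgM conjgK; apply/conj_setP; rewrite -Pi; exact: Pt.
  by move=> /eqP /(congr1 (fun A => [set` A])); rewrite !fset_setK.
(* [k ^ h] is [(k ^ g) ^ (g^-1 * h)], to which [inter] applies. *)
apply/conj_setP; rewrite -(conjgK g k) -conjgM.
suff /inter[] : subgroup_generated C ((k ^ g) ^ a) by [].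
rewrite CE conjgE; apply: subgroup_generatedM; first exact: subgroup_generatedV.
exact: subgroup_generatedM.
Qed.
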